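(* (In ZFC.) The polynomial ring $\mathbb{R}[X_k:k\in\mathbb{N}]$ in countably infinitely many variables over the field $\mathbb{R}$ of real numbers is Jacobson, but it is not $\alpha$-Jacobson for any ordinal $\alpha$.
   Context: All rings are commutative with identity (the trivial ring is allowed). For a subset $U$ of a ring $A$, $\langle U\rangle$ denotes the ideal generated by $U$, and $\mathrm{Nil}_A U:=\{x\in A:\exists n\ge 0,\ x^n\in\langle U\rangle\}$, $\mathrm{Jac}_A U:=\{x\in A:\forall a\in A,\ 1\in\langle U\cup\{1-ax\}\rangle\}$. A ring $A$ is called Jacobson if $\mathrm{Jac}_A U\subseteq\mathrm{Nil}_A U$ for every subset $U\subseteq A$. $\mathrm{Nil}_A 0$ denotes the nilradical of $A$. The image of an element in a quotient ring is denoted by the same letter. For a ring $A$, elements $x,x'\in A$ and an ordinal $\alpha$, the property ''the triple $(A,x,x')$ is $\alpha$-Jacobson'' is defined by recursion on $\alpha$: (1) $(A,x,x')$ is $0$-Jacobson if $x'\in\mathrm{Nil}_A 0$. (2) For $\alpha>0$, $(A,x,x')$ is $\alpha$-Jacobson if there exist $n\ge 0$ and $a_1,\ldots,a_n\in A$ such that for any $b_1,\ldots,b_n\in A$ there exists an ordinal $\beta<\alpha$ such that $(A/\langle 1-b_i(1-a_ix): i\in\{1,\ldots,n\}\rangle,\,x,\,x')$ is $\beta$-Jacobson. A ring $A$ is called $\alpha$-Jacobson if $(A,x,x)$ is $\alpha$-Jacobson for all $x\in A$. *)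

(* Defs.v *)
From HB Require Import structures.
From mathcomp Require Import all_boot all_order all_algebra.
From mathcomp Require Import generic_quotient ring_quotient.
From mathcomp Require Import boolp classical_sets reals.
From mathcomp Require Import monalg.

Set Implicit Arguments.
Unset Strict Implicit.
Unset Printing Implicit Defensive.

Import GRing.Theory.
Local Open Scope classical_set_scope.
Local Open Scope ring_scope.
Local Open Scope quotient_scope.

(* [comPzRingType] is the structure of commutative rings with identity in which
   1 = 0 is allowed; this matters because the quotients below may be trivial. *)

Definition ideal_gen (A : comPzRingType) (U : set A) : set A :=
  [set x | exists (n : nat) (c u : 'I_n -> A),
     (forall i, U (u i)) /\ x = \sum_(i < n) c i * u i].

Definition Nil (A : comPzRingType) (U : set A) : set A :=
  [set x | exists n : nat, ideal_gen U (x ^+ n)].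

Definition Jac (A : comPzRingType) (U : set A) : set A :=
  [set x | forall a : A, ideal_gen (U `|` [set 1 - a * x]) 1].

Definition jacobson (A : comPzRingType) : Prop :=
  forall U : set A, Jac U `<=` Nil U.

(* The quotient of A by the ideal generated by U.  The library only provides
   ring quotients by proper ideals, so the multiplication is added here to its
   quotient of additive groups. *)

Section QuotientRing.
Variables (A : comPzRingType) (U : set A).

Definition in_ideal : A -> bool := fun x => `[< ideal_gen U x >].

Lemma ideal_gen0 : ideal_gen U 0.
Proof. by exists 0, (fun=> 0), (fun=> 0); split=> [[]|]//; rewrite big_ord0. Qed.

Lemma ideal_genD x y : ideal_gen U x -> ideal_gen U y -> ideal_gen U (x + y).
Proof.
move=> [n [c [u [Uu ->]]]] [m [d [v [Uv ->]]]].
pose cat (f : 'I_n -> A) (g : 'I_m -> A) (i : 'I_(n + m)) :=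
  match split i with inl j => f j | inr k => g k end.
exists (n + m)%N, (cat c d), (cat u v); split.
  by move=> i; rewrite /cat; case: (split i).
rewrite big_split_ord /=; congr (_ + _); apply: eq_bigr => i _; rewrite /cat.
  by have /= -> := unsplitK (inl i : 'I_n + 'I_m).
by have /= -> := unsplitK (inr i : 'I_n + 'I_m).
Qed.

Lemma ideal_genMl a x : ideal_gen U x -> ideal_gen U (a * x).
Proof.
move=> [n [c [u [Uu ->]]]]; exists n, (fun i => a * c i), u; split=> //.
by rewrite mulr_sumr; apply: eq_bigr => i _; rewrite mulrA.
Qed.

Lemma in_ideal_zmod_closed : zmod_closed in_ideal.
Proof.
split=> [|x y]; first exact/asboolP/ideal_gen0.
move=> /asboolP Ix /asboolP Iy; apply/asboolP; apply: ideal_genD => //.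
by rewrite -mulN1r; apply: ideal_genMl.
Qed.

HB.instance Definition _ :=
  GRing.isZmodClosed.Build A in_ideal in_ideal_zmod_closed.

Definition add_quot := Quotient.quot (GRing.ZmodClosed.clone A in_ideal _).

Definition quot_ring : Type := add_quot.

HB.instance Definition _ := GRing.Zmodule.copy quot_ring add_quot.

Definition quot_proj (x : A) : quot_ring := \pi_add_quot x.

Lemma quot_projP x y : quot_proj x = quot_proj y <-> ideal_gen U (x - y).
Proof.
split=> [/eqP|I]; first by rewrite /quot_proj -Quotient.idealrBE => /asboolP.
by apply/eqP; rewrite /quot_proj -Quotient.idealrBE; apply/asboolP.
Qed.

Lemma quot_proj_surj (y : quot_ring) : exists x, quot_proj x = y.
Proof. by exists (repr (y : add_quot)); apply: reprK. Qed.

Definition quot_one : quot_ring := quot_proj 1.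

Definition quot_mul (x y : quot_ring) : quot_ring :=
  quot_proj (repr (x : add_quot) *
             repr (y : add_quot)).

Lemma quot_projB : zmod_morphism quot_proj.
Proof. by move=> x y; exact: raddfB. Qed.

Lemma quot_projD x y : quot_proj (x + y) = quot_proj x + quot_proj y.
Proof. by exact: raddfD. Qed.

Lemma quot_projM x y : quot_proj (x * y) = quot_mul (quot_proj x) (quot_proj y).
Proof.
have proj_repr z : quot_proj (repr (quot_proj z : add_quot)) =
  quot_proj z by exact: reprK.
have /quot_projP Ix := esym (proj_repr x).
have /quot_projP Iy := esym (proj_repr y).
apply/quot_projP; set x' := repr _ in Ix *; set y' := repr _ in Iy *.
have -> : x * y - x' * y' = y * (x - x') + x' * (y - y').
  by rewrite !mulrBr (mulrC y) (mulrC y) addrA subrK.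
by apply: ideal_genD; apply: ideal_genMl.
Qed.

Lemma quot_mulA : associative quot_mul.
Proof.
move=> x y z; case: (quot_proj_surj x) => a <-; case: (quot_proj_surj y) => b <-.
by case: (quot_proj_surj z) => c <-; rewrite -!quot_projM mulrA.
Qed.

Lemma quot_mulC : commutative quot_mul.
Proof. by move=> x y; rewrite /quot_mul mulrC. Qed.

Lemma quot_mul1 : left_id quot_one quot_mul.
Proof. by move=> x; case: (quot_proj_surj x) => a <-; rewrite -quot_projM mul1r. Qed.

Lemma quot_mulDl : left_distributive quot_mul +%R.
Proof.
move=> x y z; case: (quot_proj_surj x) => a <-; case: (quot_proj_surj y) => b <-.
case: (quot_proj_surj z) => c <-.
by rewrite -quot_projD -!quot_projM mulrDl quot_projD.
Qed.

HB.instance Definition _ := GRing.Zmodule_isComPzRing.Build quot_ring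
  quot_mulA quot_mulC quot_mul1 quot_mulDl.

HB.instance Definition _ :=
  GRing.isZmodMorphism.Build A quot_ring quot_proj quot_projB.
HB.instance Definition _ := GRing.isMonoidMorphism.Build A quot_ring quot_proj
  (conj (erefl : quot_proj 1 = 1) quot_projM).

End QuotientRing.

(* An ordinal is represented by any well-ordered type of that order type, so
   that 0 is represented by the types without elements, and beta < alpha means
   that beta is isomorphic to a proper initial segment of alpha. *)

Record Ord := MkOrd {
  ord_sort :> Type;
  ord_rel : ord_sort -> ord_sort -> Prop;
  ord_rel_trans : forall x y z, ord_rel x y -> ord_rel y z -> ord_rel x z;
  ord_rel_total : forall x y, ord_rel x y \/ x = y \/ ord_rel y x;
  ord_rel_wf : well_founded ord_rel }.

Definition ord_eq0 (alpha : Ord) : Prop := ~ inhabited alpha.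

Definition ord_seg (beta alpha : Ord) (a : alpha) : Prop :=
  exists f : beta -> alpha,
    (forall x y, ord_rel x y <-> ord_rel (f x) (f y)) /\
    (forall y, ord_rel y a <-> exists x, f x = y).

Definition ord_lt (beta alpha : Ord) : Prop :=
  exists a : alpha, ord_seg beta a.

Lemma ord_lt_wf : well_founded ord_lt.
Proof.
suff segAcc (delta : Ord) (d : delta) (alpha : Ord) : ord_seg alpha d -> Acc ord_lt alpha.
  by move=> delta; constructor=> alpha [d]; apply: segAcc.
elim/(well_founded_ind (@ord_rel_wf delta)): d alpha => d IHd alpha [f [fM fI]].
constructor=> gamma [a [g [gM gI]]].
apply: (IHd (f a)); first by apply/fI; exists a.
exists (f \o g); split=> [x y|y]; first by apply: (iff_trans (gM x y)).
split=> [ya|[x <-]]; last by apply/fM/gI; exists x.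
have /fI [z zy] : ord_rel y d.
  by apply: ord_rel_trans ya _; apply/fI; exists a.
by move: ya; rewrite -zy => /fM/gI[x <-]; exists x.
Qed.

(* The ideal <1 - b_i (1 - a_i x) : i> is the one generated by the range. *)

Definition jacobson_step (alpha : Ord)
    (rec : forall beta, ord_lt beta alpha ->
       forall A : comPzRingType, A -> A -> Prop)
    (A : comPzRingType) (x x' : A) : Prop :=
  (ord_eq0 alpha /\ Nil [set 0] x') \/
  (~ ord_eq0 alpha /\
   exists (n : nat) (a : 'I_n -> A), forall b : 'I_n -> A,
   exists (beta : Ord) (lt_beta : ord_lt beta alpha),
   let I := range (fun i => 1 - b i * (1 - a i * x)) in
   rec beta lt_beta (quot_ring I) (quot_proj I x) (quot_proj I x')).

Definition triple_jacobson :
    Ord -> forall A : comPzRingType, A -> A -> Prop :=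
  Fix ord_lt_wf (fun=> forall A : comPzRingType, A -> A -> Prop) jacobson_step.

Lemma triple_jacobsonE (alpha : Ord) (A : comPzRingType) (x x' : A) :
  triple_jacobson alpha x x' =
  jacobson_step (fun beta (_ : ord_lt beta alpha) => triple_jacobson beta) x x'.
Proof.
rewrite /triple_jacobson Fix_eq// => alpha' f g fg; congr (jacobson_step _).
by apply: functional_extensionality_dep => beta; apply/funext => lt_beta; apply: fg.
Qed.

Definition ordinal_jacobson (alpha : Ord) (A : comPzRingType) : Prop :=
  forall x : A, triple_jacobson alpha x x.

(* Finitely supported functions from commutative monomials in the variables
   X_k, k : nat, to R, i.e. the polynomial ring R[X_k : k in nat]. *)
Definition poly_nat (R : comNzRingType) : comNzRingType :=
  {malg R[{cmonom nat}]}.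

(* Main.v *)
Require Import Defs.
From HB Require Import structures.
From mathcomp Require Import all_boot all_order all_algebra finmap fraction.
From mathcomp Require Import boolp classical_sets cardinality reals.
From mathcomp Require ereal lebesgue_measure.

(** If [x] is in [Jac U], then for every [r] in [R] some [h r] inverts
    [1 - r x] modulo [<U>].  There are uncountably many [r] but only countably
    many finite sets of monomials, so infinitely many [h r] have the same
    support and are linearly dependent.  Clearing denominators in the dependence
    gives a nonzero polynomial [p] over [R] with [p(x)] in [<U>].  Write
    [p = X^m q] with [q(0) <> 0]: as [x] is in [Jac U], [q(x)] is invertible
    modulo [<U>], hence [x^m] is in [<U>].

    For the second part, think of the recursion on [alpha] as a game in which
    the [a_i] are answered by the [b_i].  Answering with fresh variables forces
    [1 - a_i x] to become invertible and nothing more.  Hence for [x = X_0] every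
    ring reached maps to the localization of [R[t]] at [t = 0] with [x |-> t],
    since [1 - a t] is invertible there for every [a]; so [x] never becomes
    nilpotent.  An ordinal [alpha] would bound the length of the game. *)

Set Implicit Arguments.
Unset Strict Implicit.
Unset Printing Implicit Defensive.

(* The notations of [lebesgue_measure] and [monalg] clash, hence the module. *)
Module Uncountable.
Import ereal lebesgue_measure Order.TTheory GRing.Theory Num.Theory.
Local Open Scope classical_set_scope.
Local Open Scope ring_scope.

(** Countable sets have Lebesgue measure zero, whereas the unit interval has measure 1. *)
Lemma uncountable_reals (R : realType) : ~ countable [set: R].
Proof.
move=> cR; have c01 : countable `[(0 : R), 1].
  by apply: sub_countable cR; apply: subset_card_le.
have := countable_lebesgue_measure0 c01.
rewrite lebesgue_measure_itv /= lte_fin ltr01 => /eqP.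
by rewrite sube0 eqe oner_eq0.
Qed.

End Uncountable.

From mathcomp Require Import monalg.

Import Order.TTheory GRing.Theory Num.Theory.
Local Open Scope classical_set_scope.
Local Open Scope ring_scope.

(** * The Jacobson property over an uncountable field *)

Lemma ideal_gen_setU1 (A : comPzRingType) (U : set A) (y z : A) :
  ideal_gen (U `|` [set y]) z -> exists h, ideal_gen U (z - h * y).
Proof.
move=> [n [c [u [Uu ->]]]]; elim: n => [|n IHn] in c u Uu *.
  by exists 0; rewrite big_ord0 mul0r subr0; apply: ideal_gen0.
have [h Ih] := IHn (c \o lift ord0) (u \o lift ord0) (fun=> Uu _).
rewrite big_ord_recl; have [Uu0|->] := Uu ord0.
  exists h; rewrite -addrA; apply: ideal_genD => //; apply: ideal_genMl.
  exists 1, (fun=> 1), (fun=> u ord0); split=> //.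
  by rewrite big_ord_recl big_ord0 mul1r addr0.
exists (c ord0 + h).
by rewrite mulrDl opprD addrACA subrr add0r.
Qed.

Lemma Jac_inverse (A : comPzRingType) (U : set A) (x : A) :
  Jac U x -> forall a, exists h, ideal_gen U (1 - h * (1 - a * x)).
Proof. by move=> Jx a; apply/ideal_gen_setU1/Jx. Qed.

Lemma ideal_gen_sum (A : comPzRingType) (U : set A) (I : Type) (s : seq I)
    (P : pred I) (f : I -> A) :
  (forall i, P i -> ideal_gen U (f i)) -> ideal_gen U (\sum_(i <- s | P i) f i).
Proof.
move=> If; elim/big_ind: _ => //; [exact: ideal_gen0|exact: ideal_genD].
Qed.

Lemma Nil_of_annihilating_poly (F : fieldType) (A : comAlgType F) (U : set A)
    (x : A) (p : {poly F}) :
  p != 0 -> Jac U x -> ideal_gen U (horner_alg x p) -> Defs.Nil U x.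
Proof.
move=> p0 Jx; have [m [q + pE]] := multiplicity_XsubC p 0.
rewrite p0 {}pE subr0 /=; elim/poly_ind: q => [|q c _]; first by rewrite root0.
rewrite rootE hornerMXaddC mulr0 add0r => c0.
rewrite !(rmorphM, rmorphD, rmorphXn) /= horner_algX horner_algC => Ipx.
(* The cofactor of the power of ['X] is now [q * 'X + c%:P] with [c != 0]. For this choice
   [1 - a * x] is [c^-1] times its value at [x], so [c^-1 *: h] inverts that value modulo [U]. *)
have [h Ih] := Jac_inverse Jx (- (c^-1 *: horner_alg x q)).
exists m.
have -> : x ^+ m = x ^+ m * (1 - h * (1 - - (c^-1 *: horner_alg x q) * x)) +
   (c^-1 *: h) * ((horner_alg x q * x + c *: 1) * x ^+ m).
  rewrite mulNr opprK mulrBr mulr1 -[LHS]addr0 -addrA; congr (_ + _).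
  have -> : 1 + c^-1 *: horner_alg x q * x = c^-1 *: (horner_alg x q * x + c *: 1).
    by rewrite scalerDr scalerA mulVf// scale1r scalerAl addrC.
  by rewrite -!scalerAr -scalerAl [x ^+ m * _]mulrC -mulrA addNr.
by apply: ideal_genD; apply: ideal_genMl.
Qed.

(** The coefficient matrix [M] has more rows than columns, hence a nonzero left kernel vector. *)
Lemma malg_linear_dependence (F : fieldType) (K : choiceType) (S : {fset K})
    (n : nat) (h : 'I_n -> {malg F[K]}) :
  (forall i, msupp (h i) `<=` S)%fset -> (#|` S| < n)%N ->
  exists2 c : 'I_n -> F, (exists i, c i != 0) & \sum_i c i *: h i = 0.
Proof.
move=> hS ltSn; pose M := \matrix_(i < n, j < #|` S|) (h i)@_(tnth (in_tuple S) j).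
have : kermx M != 0.
  rewrite kermx_eq0 /row_free; apply: contraTneq ltSn => <-.
  by rewrite -leqNgt rank_leq_col.
case/rowV0Pn => c /sub_kermxP cM /rV0Pn[i ci].
exists (c ord0); first by exists i.
apply/malgP => k; rewrite mcoeff0 raddf_sum /=.
have [kS|kS] := boolP (k \in S); last first.
  rewrite big1// => j _; rewrite mcoeffZ mcoeff_outdom ?mulr0//.
  by apply: contra kS; apply: fsubsetP.
have /(congr1 (fun A : 'rV_ _ => A ord0)) := cM.
have kS' : (index k S < #|` S|)%N by rewrite index_mem.
move=> /(congr1 (fun f => f (Ordinal kS'))); rewrite !mxE => cM0; rewrite -[RHS]cM0.
apply: eq_bigr => j _; rewrite mcoeffZ mxE; congr (_ * _@_ _).
by rewrite (tnth_nth k) /= nth_index.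
Qed.

HB.instance Definition _ (I : countType) := [Countable of {cmonom I} by <:].

(** This is the numerator of the sum of the fractions [c i / (1 - r i X)]. At [(r k)^-1] every
    summand but the [k]-th vanishes. *)
Lemma poly_resolvent_neq0 (F : fieldType) n (r c : 'I_n -> F) k :
  injective r -> r k != 0 -> c k != 0 ->
  \sum_i c i *: \prod_(j | j != i) (1 - r j *: 'X) != 0 :> {poly F}.
Proof.
move=> rI rk ck; apply/eqP => /(congr1 (horner_eval (r k)^-1)).
rewrite raddf_sum (bigD1 k)//= [X in _ + X]big1 => [|i ik]; last first.
  rewrite /horner_eval hornerZ horner_prod (bigD1 k) 1?eq_sym//=.
  by rewrite !hornerE divff// subrr /= mulr0 mul0r.
rewrite /horner_eval horner0 addr0 hornerZ horner_prod.
move=> /eqP; rewrite mulf_eq0 (negPf ck) /=.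
apply/negP/prodf_neq0 => j jk; rewrite !hornerE subr_eq0 eq_sym.
by apply: contra jk => /eqP/divr1_eq/rI ->.
Qed.

(** Modulo [U], multiplying the dependence by the product [E] of all [1 - r i *: x] cancels each
    [h i] against its own factor and leaves a polynomial in [x]. *)
Lemma Nil_of_dependent_resolvents (F : fieldType) (A : comAlgType F) (U : set A)
    (x : A) n (r c : 'I_n -> F) (h : 'I_n -> A) k :
  injective r -> r k != 0 -> c k != 0 -> \sum_i c i *: h i = 0 ->
  (forall i, ideal_gen U (1 - h i * (1 - r i *: x))) ->
  Jac U x -> Defs.Nil U x.
Proof.
move=> rI rk ck hc hP Jx.
apply: (Nil_of_annihilating_poly (poly_resolvent_neq0 rI rk ck)) => //.
pose E : A := \prod_i (1 - r i *: x).
have -> : horner_alg x (\sum_i c i *: \prod_(j | j != i) (1 - r j *: 'X)) =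
    \sum_i (c i *: \prod_(j | j != i) (1 - r j *: x)) * (1 - h i * (1 - r i *: x))
    + E * \sum_i c i *: h i.
  rewrite mulr_sumr -big_split /= linear_sum; apply: eq_bigr => i _.
  have hE s : horner_alg x (1 - s *: 'X) = 1 - s *: x.
    by rewrite raddfB /= rmorph1 linearZ /= horner_algX mulr_algl.
  rewrite linearZ rmorph_prod /= (eq_bigr _ (fun j _ => hE (r j))).
  rewrite mulr_algl; set P := \prod_(j | j != i) (1 - r j *: x).
  have -> : E = (1 - r i *: x) * P by rewrite /E (bigD1 i).
  rewrite mulrBr mulr1 -addrA -[LHS]addr0; congr (_ + _).
  by rewrite -scalerAl -scalerAr [_ * P * _]mulrAC [_ * P]mulrC [_ * h i]mulrC addNr.
rewrite hc mulr0 addr0; apply: ideal_gen_sum => i _.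
exact: ideal_genMl.
Qed.

Lemma jacobson_poly_nat (F : fieldType) :
  ~ countable [set: F] -> jacobson (poly_nat F).
Proof.
move=> uncF U x Jx; pose A := {malg F[{cmonom nat}]}.
have /choice[h hP] (r : F) : exists h : A, ideal_gen U (1 - h * (1 - r *: x)).
  have [h Ih] := Jac_inverse Jx (r *: (1 : A)); exists h.
  by rewrite -[r *: (x : A)]mulr_algl.
(* Otherwise [F] would be a countable union of finite fibres. *)
have [S infS] : exists S : {fset {cmonom nat}}, infinite_set [set r | msupp (h r) = S].
  apply: contrapT => /forallNP finh; apply: uncF.
  have -> : [set: F] = \bigcup_(S in [set: {fset {cmonom nat}}]) [set r | msupp (h r) = S].
    by apply/seteqP; split=> // r _; exists (msupp (h r)).
  apply: bigcup_countable => [|S _]; first exact: countableP.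
  by apply: finite_set_countable; apply: contrapT; apply: finh.
(* Zero is removed since [r k] must be invertible. *)
have [D DS ltD] := infinite_set_fset #|` S|.+1 (infinite_setD infS (finite_set1 0)).
pose r (i : 'I_#|` D|) := tnth (in_tuple D) i.
have rD i : r i \in D by exact: mem_tnth.
have rI : injective r by apply/tuple_uniqP/fset_uniq.
have [|c [k ck] hc] := @malg_linear_dependence F _ S _ (h \o r) _ ltD.
  by move=> i /=; have [<-] := DS _ (rD i).
apply: (@Nil_of_dependent_resolvents F A U x _ r c (h \o r) k) => //.
  by apply/eqP; have [_] := DS _ (rD k).
by move=> i; exact: hP.
Qed.

(** * Evaluation of polynomials in countably many variables *)

Lemma rmorph_inverse_relation (A B : comPzRingType) (f : {rmorphism A -> B})
    (a b x : A) :
  f (1 - b * (1 - a * x)) = 1 - f b * (1 - f a * f x).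
Proof. by rewrite !(rmorphB, rmorphM, rmorph1). Qed.

Section Evaluation.
Variables (R : comNzRingType) (S : comNzRingType) (f : {rmorphism R -> S}).

Definition monom_eval (v : nat -> S) (m : {cmonom nat}) : S :=
  \prod_(i <- finsupp m) v i ^+ m i.

Lemma monom_evalEw v (m : {cmonom nat}) (d : {fset nat}) :
  (finsupp m `<=` d)%fset -> monom_eval v m = \prod_(i <- d) v i ^+ m i.
Proof.
move=> md; rewrite /monom_eval (big_fset_incl _ md)// => i _ im.
by rewrite fsfun_dflt.
Qed.

Lemma monom_eval_mmorphism v : mmorphism (monom_eval v).
Proof.
split=> [x y|]; last by rewrite /monom_eval mdom1 big_seq_fset0.
rewrite (@monom_evalEw v x (finsupp x `|` finsupp y)%fset) ?fsubsetUl//.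
rewrite (@monom_evalEw v y (finsupp x `|` finsupp y)%fset) ?fsubsetUr//.
rewrite (@monom_evalEw v _ (finsupp x `|` finsupp y)%fset) ?mdomD//.
by rewrite -big_split /=; apply: eq_bigr => i _; rewrite cmM exprD.
Qed.

HB.instance Definition _ v :=
  monalg.isMultiplicative.Build {cmonom nat} S (monom_eval v)
    (monom_eval_mmorphism v).

Definition peval (v : nat -> S) : {rmorphism poly_nat R -> S} :=
  mmap f (monom_eval v).

Definition pvar (i : nat) : poly_nat R := << ucm i >>.

Lemma peval_var v i : peval v (pvar i) = v i.
Proof.
rewrite /peval /pvar /= mmapU [X in X * _](rmorph1 f) mul1r /monom_eval mdomU.
by rewrite big_seq_fset1 cmUU.
Qed.

Lemma peval_inverse_relation v (a : poly_nat R) i j :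
  peval v (1 - pvar i * (1 - a * pvar j)) = 1 - v i * (1 - peval v a * v j).
Proof. by rewrite -[v i]peval_var -[v j]peval_var rmorph_inverse_relation. Qed.

Lemma peval_fin_dep (p : poly_nat R) : exists N : nat, forall v w,
  (forall i, (i < N)%N -> v i = w i) -> peval v p = peval w p.
Proof.
exists (\max_(m <- msupp p) \max_(i <- finsupp (m : {cmonom nat})) i.+1)%N => v w vw.
rewrite /peval /= !mmapE; apply: eq_big_seq => m mp; congr (_ * _).
apply: eq_big_seq => i im; rewrite vw//.
rewrite (big_rem m)//= (big_rem i)//=.
by rewrite -maxnA leq_maxl.
Qed.

(** With a bare predicate [P], the local ring used below can remain a subset of its fraction
    field. *)
Lemma peval_pred (P : S -> Prop) (v : nat -> S) (p : poly_nat R) :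
  P 0 -> P 1 -> (forall x y, P x -> P y -> P (x + y)) ->
  (forall x y, P x -> P y -> P (x * y)) ->
  (forall c, P (f c)) -> (forall i, P (v i)) -> P (peval v p).
Proof.
move=> P0 P1 PD PM Pf Pv; rewrite /peval /= mmapE.
apply: (big_ind P P0 PD) => m _; apply: (PM) => //.
apply: (big_ind P P1 PM) => i _.
by elim: (m i) => // n IHn; rewrite exprS; apply: PM.
Qed.

End Evaluation.

(** * Quotients with a map to the local ring at [t = 0] *)

Section NotOrdinalJacobson.
Variable R : idomainType.
Local Notation K := {fraction {poly R}}.

Definition const_frac : {rmorphism R -> K} := @tofrac {poly R} \o @polyC R.

Local Notation "x %:F" := (@tofrac _ x).
Local Notation ev := (peval const_frac).
Local Notation t := ('X%:F : K).

(* The local ring of R[t] at t = 0. *)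
Definition regular0 (x : K) : Prop :=
  exists p q : {poly R}, q.[0] != 0 /\ x = p%:F / q%:F.

Lemma horner0_neq0 (q : {poly R}) : q.[0] != 0 -> q%:F != 0.
Proof. by move=> q0; rewrite tofrac_eq0; apply: contraNneq q0 => ->; rewrite horner0. Qed.

Lemma regular0_tofrac p : regular0 p%:F.
Proof. by exists p, 1; rewrite hornerC oner_eq0 tofrac1 divr1. Qed.

Lemma regular0D x y : regular0 x -> regular0 y -> regular0 (x + y).
Proof.
move=> [p [q [q0 ->]]] [r [s [s0 ->]]]; exists (p * s + r * q), (q * s).
rewrite hornerM mulf_neq0// tofracD !tofracM addf_div//; exact: horner0_neq0.
Qed.

Lemma regular0M x y : regular0 x -> regular0 y -> regular0 (x * y).
Proof.
move=> [p [q [q0 ->]]] [r [s [s0 ->]]]; exists (p * r), (q * s).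
by rewrite hornerM mulf_neq0// !tofracM mulf_div.
Qed.

(** For [x = p / q], the numerator [q - p * 'X] of [1 - x * t] has the value [q.[0] != 0] at 0. *)
Lemma regular0_unit x : regular0 x ->
  1 - x * t != 0 /\ regular0 (1 - x * t)^-1.
Proof.
move=> [p [q [q0 ->]]].
have q1 : (q - p * 'X).[0] != 0 by rewrite hornerD hornerN hornerM hornerX mulr0 subr0.
have -> : 1 - p%:F / q%:F * t = (q - p * 'X)%:F / q%:F.
  by rewrite tofracB tofracM mulrBl divff ?horner0_neq0// mulrAC.
split; first by rewrite mulf_neq0 ?invr_neq0 ?horner0_neq0.
by exists q, (q - p * 'X); rewrite invf_div.
Qed.

Lemma regular0_ev u p : (forall i, regular0 (u i)) -> regular0 (ev u p).
Proof.
move=> ru; apply: peval_pred => //.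
- exact: (regular0_tofrac 0).
- exact: (regular0_tofrac 1).
- exact: regular0D.
- exact: regular0M.
- by move=> c; exact: regular0_tofrac.
Qed.

(* B is a quotient of the polynomial ring by relations that only constrain the
   first N variables, and these have the solution u in the local ring. *)
Definition finitely_constrained (B : comPzRingType) (x : B) : Prop :=
  exists (pi : {rmorphism poly_nat R -> B}) (N : nat) (u : nat -> K),
  [/\ forall b, exists a, pi a = b,
      pi (pvar R 0) = x,
      (0 < N)%N /\ u 0%N = t,
      forall i, regular0 (u i)
    & forall v, (forall i, (i < N)%N -> v i = u i) ->
      forall p, pi p = 0 -> ev v p = 0].

Lemma finitely_constrained_poly_nat :
  finitely_constrained (pvar R 0 : poly_nat R).
Proof.
exists idfun, 1%N, (fun i => if i == 0%N then t else 0); split=> //.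
- by move=> b; exists b.
- by case=> [|i]; exact: regular0_tofrac.
- by move=> v _ p /= ->; rewrite rmorph0.
Qed.

Lemma finitely_constrained_not_nil (B : comPzRingType) (x : B) :
  finitely_constrained x -> ~ Defs.Nil [set 0] x.
Proof.
move=> [pi [N [u [_ <- [N0 u0] _ kerpi]]]] [n [m [c [w [w0 xn]]]]].
have : pi (pvar R 0 ^+ n) = 0.
  by rewrite rmorphXn /= xn big1// => i _; rewrite w0 mulr0.
move=> /(kerpi u (fun _ _ => erefl)) /eqP.
by rewrite rmorphXn /= peval_var u0 expf_eq0 tofrac_eq0 polyX_eq0 andbF.
Qed.

Lemma finitely_constrained_quot (B : comPzRingType) (x : B)
    (n : nat) (a : 'I_n -> B) :
  finitely_constrained x -> exists b : 'I_n -> B,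
  let I := range (fun i => 1 - b i * (1 - a i * x)) in
  finitely_constrained (quot_proj I x).
Proof.
move=> [pi [N [u [pi_surj pi0 [N0 u0] ru kerpi]]]].
have /choice[a' a'E] i : exists a', pi a' = a i by exact: pi_surj.
have /choice[M a'M] i := peval_fin_dep const_frac (a' i).
(* Beyond both the constrained variables and those on which the evaluations of the lifts [a' i]
   depend. *)
pose N' := maxn N (\max_i M i).
have NN' : (N <= N')%N by exact: leq_maxl.
have MN' i : (M i <= N')%N by rewrite leq_max leq_bigmax orbT.
(* The answers b are fresh variables, to be evaluated at the inverses. *)
exists (fun i => pi (pvar R (N' + i))) => I.
(* The value 0 from [N' + n] on is an arbitrary element of the local ring. *)
pose u' k : K := if (k < N')%N then u k else
  if insub (k - N')%N is Some i then (1 - ev u (a' i) * t)^-1 else 0.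
have u'lt k : (k < N')%N -> u' k = u k by rewrite /u' => ->.
have u'ge (i : 'I_n) : u' (N' + i)%N = (1 - ev u (a' i) * t)^-1.
  by rewrite /u' ltnNge leq_addr /= addKn valK.
exists (quot_proj I \o pi), (N' + n)%N, u'; split.
- move=> b; have [b' <-] := quot_proj_surj b.
  by have [p <-] := pi_surj b'; exists p.
- by rewrite /= pi0.
- by rewrite u'lt ?ltn_addr// (leq_trans N0).
- move=> k; rewrite /u'; case: ifP => // _.
  case: insubP => [i _ _|_]; last exact: (regular0_tofrac 0).
  by have [] := regular0_unit (regular0_ev (a' i) ru).
move=> v vu' p /= /eqP; rewrite -(rmorph0 (quot_proj I)) => /eqP/quot_projP.
rewrite subr0 => -[m [c [w [wI pE]]]].
have vu k : (k < N')%N -> v k = u k.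
  by move=> kN; rewrite vu' ?u'lt// (leq_trans kN)// leq_addr.
have ker_v q : pi q = 0 -> ev v q = 0.
  by apply: kerpi => k kN; apply: vu; apply: leq_trans NN'.
have /choice[c' c'E] j : exists c', pi c' = c j by exact: pi_surj.
(* Each generator lifts to a polynomial killed by [ev v], because [v] sends its fresh variable to
   the required inverse. *)
have /choice[w' w'E] j : exists w', pi w' = w j /\ ev v w' = 0.
  have [i _ <-] := wI j; exists (1 - pvar R (N' + i) * (1 - a' i * pvar R 0)).
  split; first by rewrite rmorph_inverse_relation a'E -pi0.
  rewrite peval_inverse_relation vu' ?ltn_add2l// u'ge vu ?(leq_trans N0)// u0.
  rewrite (a'M i v u) => [|k kM]; last by apply/vu/(leq_trans kM).
  by rewrite mulVf ?subrr//; have [] := regular0_unit (regular0_ev (a' i) ru).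
(* The difference lies in the kernel of [pi], so the old constraints apply to it. *)
have : ev v (p - \sum_j c' j * w' j) = 0.
  apply: ker_v; rewrite rmorphB rmorph_sum /= pE; apply/eqP; rewrite subr_eq0.
  by apply/eqP/eq_bigr => j _; rewrite rmorphM /= c'E; have [->] := w'E j.
rewrite rmorphB rmorph_sum /= big1 ?subr0// => j _.
by rewrite rmorphM /=; have [_ ->] := w'E j; rewrite mulr0.
Qed.

Lemma finitely_constrained_not_jacobson (alpha : Ord) (B : comPzRingType) (x : B) :
  finitely_constrained x -> ~ triple_jacobson alpha x x.
Proof.
elim/(well_founded_ind ord_lt_wf): alpha B x => alpha IH B x Bx.
rewrite triple_jacobsonE => -[[_]|[_ [n [a jac]]]].
  exact: finitely_constrained_not_nil.
have [b Bb] := finitely_constrained_quot a Bx.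
by have [beta [lt_beta]] := jac b; apply: IH.
Qed.

Lemma not_ordinal_jacobson_poly_nat (alpha : Ord) :
  ~ ordinal_jacobson alpha (poly_nat R).
Proof.
move=> /(_ (pvar R 0)); apply: finitely_constrained_not_jacobson.
exact: finitely_constrained_poly_nat.
Qed.

End NotOrdinalJacobson.

Theorem mainTheorem4 (R : realType) :
  jacobson (poly_nat R) /\
  (forall alpha : Ord, ~ ordinal_jacobson alpha (poly_nat R)).
Proof.
split; first exact/jacobson_poly_nat/Uncountable.uncountable_reals.
exact: not_ordinal_jacobson_poly_nat.
Qed.
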